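(* Let $\mathbf x=(x_1,x_2,x_3,x_4,x_5,x_6,x_7)\in\mathbb C^7$. Then the following conditions are equivalent: (1) $\mathbf x\in G_{E(3;3;1,1,1)}$; (2) $(x_1,\,x_3+\eta x_5,\,\eta x_7,\,x_2+\eta x_4,\,\eta x_6)\in G_{E(3;2;1,2)}$ for all $\eta\in\mathbb T$; (3) $(x_1,\,x_3+\eta x_5,\,\eta x_7,\,x_2+\eta x_4,\,\eta x_6)\in G_{E(3;2;1,2)}$ for all $\eta\in\bar{\mathbb D}$.
   Context: $\mathbb T$ is the unit circle and $\bar{\mathbb D}$ the closed unit disc. For a linear subspace $E$ of $\mathcal M_{n\times n}(\mathbb C)$, $\mu_E(A)=1/\inf\{\|X\|: X\in E,\ \det(I-AX)=0\}$, with $\mu_E(A)=0$ if $I-AX$ is nonsingular for all $X\in E$ (operator norm). $E(3;3;1,1,1)$ is the space of $3\times 3$ diagonal matrices and $E(3;2;1,2)=\{\operatorname{diag}(z_1,z_2,z_2): z_1,z_2\in\mathbb C\}$. For $A=((a_{ij}))\in\mathcal M_{3\times3}(\mathbb C)$ put $$\pi(A)=\big(a_{11},\ a_{22},\ a_{11}a_{22}-a_{12}a_{21},\ a_{33},\ a_{11}a_{33}-a_{13}a_{31},\ a_{22}a_{33}-a_{23}a_{32},\ \det A\big),$$ $$\tilde\pi(A)=\big(a_{11},\ (a_{11}a_{22}-a_{12}a_{21})+(a_{11}a_{33}-a_{13}a_{31}),\ \det A,\ a_{22}+a_{33},\ a_{22}a_{33}-a_{23}a_{32}\big).$$ Then $G_{E(3;3;1,1,1)}=\{\pi(A):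 \mu_{E(3;3;1,1,1)}(A)<1\}\subset\mathbb C^7$ and $G_{E(3;2;1,2)}=\{\tilde\pi(A): \mu_{E(3;2;1,2)}(A)<1\}\subset\mathbb C^5$, with $A$ ranging over $\mathcal M_{3\times 3}(\mathbb C)$. *)

(* Defs.v *)
From HB Require Import structures.
From mathcomp Require Import all_boot all_order all_algebra.
From mathcomp Require Import complex.
From mathcomp Require Import boolp classical_sets reals.
Set Implicit Arguments.
Unset Strict Implicit.
Unset Printing Implicit Defensive.

Import Order.TTheory GRing.Theory Num.Theory.
Local Open Scope classical_set_scope.
Local Open Scope ring_scope.
Local Open Scope complex_scope.

Definition l2norm (R : realType) (n : nat) (v : 'cV[R[i]]_n) : R :=
  Num.sqrt (\sum_(i < n) (Normc.normc (v i 0)) ^+ 2).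

Definition opnorm (R : realType) (n : nat) (X : 'M[R[i]]_n) : R :=
  sup [set l2norm (X *m v) | v in [set v : 'cV[R[i]]_n | l2norm v <= 1]].

(* The structured singular value.  When the set below is nonempty, its infimum
   is positive, since [\det (1 - A X) = 0] forces [1 <= opnorm A * opnorm X];
   so the real-valued inverse never hits the convention [0^-1 = 0]. *)
Definition mu (R : realType) (n : nat) (E : set 'M[R[i]]_n)
    (A : 'M[R[i]]_n) : R :=
  if `[< exists2 X, E X & \det (1%:M - A *m X) = 0 >]
  then 1 / inf [set opnorm X | X in [set X | E X /\ \det (1%:M - A *m X) = 0]]
  else 0.

Definition E_3_3_111 (R : realType) : set 'M[R[i]]_3 := [set X | is_diag_mx X].

Definition E_3_2_12 (R : realType) : set 'M[R[i]]_3 :=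
  [set X | exists z1 z2 : R[i], X = diag_mx (\row_(i < 3) [:: z1; z2; z2]`_i)].

(* Matrix indices start at 0: the entry a_{jk} is [A (j-1) (k-1)]. *)
Definition pi7 (R : realType) (A : 'M[R[i]]_3) : 7.-tuple R[i] :=
  [tuple A 0 0;
         A 1 1;
         A 0 0 * A 1 1 - A 0 1 * A 1 0;
         A 2 2;
         A 0 0 * A 2 2 - A 0 2 * A 2 0;
         A 1 1 * A 2 2 - A 1 2 * A 2 1;
         \det A].

Definition pi5 (R : realType) (A : 'M[R[i]]_3) : 5.-tuple R[i] :=
  [tuple A 0 0;
         (A 0 0 * A 1 1 - A 0 1 * A 1 0) + (A 0 0 * A 2 2 - A 0 2 * A 2 0);
         \det A;
         A 1 1 + A 2 2;
         A 1 1 * A 2 2 - A 1 2 * A 2 1].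

Definition G_3_3_111 (R : realType) : set (7.-tuple R[i]) :=
  [set pi7 A | A in [set A : 'M[R[i]]_3 | mu (@E_3_3_111 R) A < 1]].

Definition G_3_2_12 (R : realType) : set (5.-tuple R[i]) :=
  [set pi5 A | A in [set A : 'M[R[i]]_3 | mu (@E_3_2_12 R) A < 1]].

(* Main.v *)
Require Import Defs.
From HB Require Import structures.
From mathcomp Require Import all_boot all_order all_algebra.
From mathcomp Require Import complex.
From mathcomp Require Import boolp classical_sets reals.
From mathcomp Require Import topology normedtype derive realfun.
From mathcomp Require Import ring.
Set Implicit Arguments.
Unset Strict Implicit.
Unset Printing Implicit Defensive.

Import Order.TTheory GRing.Theory Num.Theory.
Import numFieldNormedType.Exports.
Local Open Scope classical_set_scope.
Local Open Scope ring_scope.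

(** By compactness, [mu_E(A) < 1] says that [det(I - AX)] has no zero [X] in [E]
    of norm at most 1.  For [X = diag(z1, z2, z3)] this determinant is a
    multi-affine polynomial [P(z1, z2, z3)] whose coefficients are the entries of
    [pi(A)], every point of [C^7] is some [pi(A)], and the polynomial attached to
    the point with parameter [eta] is [P(z1, z2, eta z2)].  So one must show that
    if [P(z1, z2, z3) <> 0] whenever [|z1|, |z2| <= 1] and [|z3| = |z2|], then [P]
    has no zero in the closed polydisc.  If [|z3| <= |z2|], write
    [P(t z1, t z2, eta t z2) = a(t) + eta b(t)] for [t] in [[0, 1]]: non-vanishing
    on [|eta| = 1] gives [|a(t)| <> |b(t)|], and [b(0) = 0], so [|a| > |b|] along
    the whole segment by the intermediate value theorem.  The case
    [|z2| <= |z3|] follows by exchanging [z2] and [z3]. *)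

Local Notation normc := Normc.normc.

(** * Continuity of complex-valued functions *)

(** Continuity is required of the real and imaginary parts, which reduces every argument to
    real-valued functions. *)
Definition ccontinuous (R : realType) (T : topologicalType) (F : T -> R[i]) :=
  continuous (fun t => complex.Re (F t)) /\ continuous (fun t => complex.Im (F t)).

Section ComplexContinuity.
Variables (R : realType) (T : topologicalType).
Implicit Types F G : T -> R[i].

Lemma ccontinuous_cst (c : R[i]) : ccontinuous (fun _ : T => c).
Proof. by split=> t; apply: cvg_cst. Qed.

Lemma ccontinuousD F G : ccontinuous F -> ccontinuous G ->
  ccontinuous (fun t => F t + G t).
Proof.
move=> [F1 F2] [G1 G2]; split.
- have -> : (fun t => complex.Re (F t + G t)) =
            (fun t => complex.Re (F t) + complex.Re (G t)).
    by apply/funext => t; case: (F t) (G t) => ? ? [].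
  by move=> t; apply: cvgD; [apply: F1|apply: G1].
- have -> : (fun t => complex.Im (F t + G t)) =
            (fun t => complex.Im (F t) + complex.Im (G t)).
    by apply/funext => t; case: (F t) (G t) => ? ? [].
  by move=> t; apply: cvgD; [apply: F2|apply: G2].
Qed.

Lemma ccontinuousM F G : ccontinuous F -> ccontinuous G ->
  ccontinuous (fun t => F t * G t).
Proof.
move=> [F1 F2] [G1 G2]; split.
- have -> : (fun t => complex.Re (F t * G t)) =
            (fun t => complex.Re (F t) * complex.Re (G t)
                      - complex.Im (F t) * complex.Im (G t)).
    by apply/funext => t; case: (F t) (G t) => ? ? [].
  by move=> t; apply: cvgB; apply: cvgM;
    [apply: F1|apply: G1|apply: F2|apply: G2].
- have -> : (fun t => complex.Im (F t * G t)) =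
            (fun t => complex.Re (F t) * complex.Im (G t)
                      + complex.Im (F t) * complex.Re (G t)).
    by apply/funext => t; case: (F t) (G t) => ? ? [].
  by move=> t; apply: cvgD; apply: cvgM;
    [apply: F1|apply: G2|apply: F2|apply: G1].
Qed.

Lemma ccontinuousN F : ccontinuous F -> ccontinuous (fun t => - F t).
Proof.
move=> cF; have := ccontinuousM (ccontinuous_cst (-1)) cF.
by congr ccontinuous; apply/funext => t; rewrite mulN1r.
Qed.

Lemma ccontinuous_sum (I : Type) (s : seq I) (P : pred I) (F : I -> T -> R[i]) :
  (forall i, ccontinuous (F i)) ->
  ccontinuous (fun t => \sum_(i <- s | P i) F i t).
Proof.
move=> cF; elim: s => [|i s IHs].
  rewrite (_ : (fun t => _) = fun=> 0); first exact: ccontinuous_cst.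
  by apply/funext => t; rewrite big_nil.
have [Pi|nPi] := boolP (P i).
  rewrite (_ : (fun t => _) = fun t => F i t + \sum_(j <- s | P j) F j t).
    exact: ccontinuousD.
  by apply/funext => t; rewrite big_cons Pi.
rewrite (_ : (fun t => _) = fun t => \sum_(j <- s | P j) F j t) //.
by apply/funext => t; rewrite big_cons (negPf nPi).
Qed.

Lemma ccontinuous_prod (I : Type) (s : seq I) (P : pred I) (F : I -> T -> R[i]) :
  (forall i, ccontinuous (F i)) ->
  ccontinuous (fun t => \prod_(i <- s | P i) F i t).
Proof.
move=> cF; elim: s => [|i s IHs].
  rewrite (_ : (fun t => _) = fun=> 1); first exact: ccontinuous_cst.
  by apply/funext => t; rewrite big_nil.
have [Pi|nPi] := boolP (P i).
  rewrite (_ : (fun t => _) = fun t => F i t * \prod_(j <- s | P j) F j t).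
    exact: ccontinuousM.
  by apply/funext => t; rewrite big_cons Pi.
rewrite (_ : (fun t => _) = fun t => \prod_(j <- s | P j) F j t) //.
by apply/funext => t; rewrite big_cons (negPf nPi).
Qed.

Lemma ccontinuous_det n (M : T -> 'M[R[i]]_n) :
  (forall i j, ccontinuous (fun t => M t i j)) ->
  ccontinuous (fun t => \det (M t)).
Proof.
move=> cM; apply: ccontinuous_sum => s; apply: ccontinuousM.
  exact: ccontinuous_cst.
by apply: ccontinuous_prod => i; apply: cM.
Qed.

Lemma continuous_normc F : ccontinuous F -> continuous (fun t => normc (F t)).
Proof.
move=> [F1 F2].
have -> : (fun t => normc (F t)) = Num.sqrt \o
    (fun t => complex.Re (F t) * complex.Re (F t)
              + complex.Im (F t) * complex.Im (F t)).
  by apply/funext => t /=; case: (F t) => ? ?; rewrite /= !expr2.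
move=> t; apply: continuous_comp; last exact: sqrt_continuous.
by apply: cvgD; apply: cvgM; [apply: F1|apply: F1|apply: F2|apply: F2].
Qed.

Lemma continuous_bigmax (I : Type) (s : seq I) (f : I -> T -> R) :
  (forall i, continuous (f i)) ->
  continuous (fun t => \big[Num.max/0]_(i <- s) f i t).
Proof.
move=> cf; elim: s => [|i s IHs].
  rewrite (_ : (fun t => _) = fun=> 0); first by move=> t; apply: cvg_cst.
  by apply/funext => t; rewrite big_nil.
rewrite (_ : (fun t => _) =
    fun t => Num.max (f i t) (\big[Num.max/0]_(j <- s) f j t)); last first.
  by apply/funext => t; rewrite big_cons.
by move=> t; apply: (@continuous_max R T (f i) _ t); [apply: cf|apply: IHs].
Qed.

End ComplexContinuity.

(** * Vector norms and the operator norm of a diagonal matrix *)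

Lemma normc_ge0 (R : realType) (z : R[i]) : 0 <= normc z.
Proof. by case: z => a b; apply: sqrtr_ge0. Qed.

Lemma normrE (R : realType) (z : R[i]) : `|z| = ((normc z)%:C)%C.
Proof. by rewrite normc_def; case: z. Qed.

Lemma l2norm_ge0 (R : realType) n (v : 'cV[R[i]]_n) : 0 <= l2norm v.
Proof. exact: sqrtr_ge0. Qed.

Lemma normc_le_l2norm (R : realType) n (v : 'cV[R[i]]_n) i :
  normc (v i 0) <= l2norm v.
Proof.
rewrite /l2norm -[leLHS]ger0_norm ?normc_ge0 // -sqrtr_sqr ler_wsqrtr //.
by rewrite (bigD1 i) //= lerDl sumr_ge0 // => j _; rewrite sqr_ge0.
Qed.

Lemma l2norm_delta (R : realType) n (i : 'I_n) :
  l2norm (delta_mx i 0 : 'cV[R[i]]_n) = 1.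
Proof.
rewrite /l2norm (bigD1 i) //= big1 => [|j /negPf ji]; rewrite mxE ?ji ?eqxx.
  by rewrite addr0 Normc.normc1 expr1n sqrtr1.
by rewrite Normc.normc0 expr0n.
Qed.

Lemma l2norm_diag_le (R : realType) n (d : 'rV[R[i]]_n) (c : R) v :
  0 <= c -> (forall i, normc (d 0 i) <= c) ->
  l2norm (diag_mx d *m v) <= c * l2norm v.
Proof.
move=> c0 dc; rewrite /l2norm -[c in leRHS]ger0_norm // -sqrtr_sqr.
rewrite -sqrtrM ?sqr_ge0 // ler_wsqrtr // mulr_sumr ler_sum // => i _.
rewrite mul_diag_mx mxE Normc.normcM exprMn ler_wpM2r ?sqr_ge0 //.
by rewrite lerXn2r ?nnegrE ?normc_ge0.
Qed.

(** The basis vector [delta_mx i 0] has norm 1 and is scaled by [d 0 i], which bounds each entry;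
    conversely [l2norm_diag_le] bounds the image of the unit ball. *)
Lemma opnorm_diag_le (R : realType) n (d : 'rV[R[i]]_n) (c : R) : 0 <= c ->
  opnorm (diag_mx d) <= c <-> forall i, normc (d 0 i) <= c.
Proof.
move=> c0; rewrite /opnorm; set A := [set _ | _ in _].
have A0 : A !=set0.
  by exists (l2norm (diag_mx d *m 0)), 0 => //=;
    rewrite /l2norm big1 ?sqrtr0 // => i _; rewrite mxE Normc.normc0 expr0n.
have ubA e : 0 <= e -> (forall i, normc (d 0 i) <= e) -> ubound A e.
  move=> e0 de _ [v /= v1 <-]; apply: le_trans (l2norm_diag_le v e0 de) _.
  by rewrite ler_piMr.
split=> [le_c i|dc]; last by apply: ge_sup => //; apply: ubA.
apply: le_trans le_c; apply: (@le_trans _ _ (l2norm (diag_mx d *m delta_mx i 0))).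
  apply: le_trans (normc_le_l2norm _ i).
  by rewrite mul_diag_mx !mxE !eqxx mulr1.
apply: ub_le_sup; last by exists (delta_mx i 0) => //=; rewrite l2norm_delta.
(* Any upper bound will do here; it only ensures that the supremum is a genuine one. *)
exists (\sum_j normc (d 0 j)); apply: ubA => [|j].
  by rewrite sumr_ge0 // => j _; rewrite normc_ge0.
by rewrite (bigD1 j) //= lerDl sumr_ge0 // => k _; rewrite normc_ge0.
Qed.

Lemma bigmax_le_ord (R : realType) n (f : 'I_n -> R) (c : R) : 0 <= c ->
  \big[Num.max/0]_i f i <= c <-> forall i, f i <= c.
Proof.
move=> c0; split=> [h i|h]; last exact: bigmax_le.
by apply: le_trans h; apply: le_bigmax.
Qed.

Lemma opnorm_ge0 (R : realType) n (X : 'M[R[i]]_n) : 0 <= opnorm X.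
Proof.
rewrite /opnorm; set A := [set _ | _ in _].
(* A set without a supremum has [sup] equal to 0 by convention. *)
have [supA|/sup_out -> //] := pselect (has_sup A).
have [a Aa] := supA.1; apply: le_trans (ub_le_sup supA.2 Aa).
by have [v _ <-] := Aa; apply: l2norm_ge0.
Qed.

Lemma opnorm_diag (R : realType) n (d : 'rV[R[i]]_n) :
  opnorm (diag_mx d) = \big[Num.max/0]_i normc (d 0 i).
Proof.
have max0 : 0 <= \big[Num.max/0]_i normc (d 0 i) by apply: bigmax_ge_id.
apply/le_anti/andP; split.
  by apply/(opnorm_diag_le d max0)/bigmax_le_ord.
by apply/bigmax_le_ord; rewrite ?opnorm_ge0//; apply/opnorm_diag_le;
  rewrite ?opnorm_ge0.
Qed.

(** * Compactness of polydiscs and the criterion for [mu < 1] *)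

(** Complex rows are parametrised by pairs of real rows, where products of segments are known to be
    compact. *)
Definition complex_row (R : realType) n (u : 'rV[R]_n * 'rV[R]_n) : 'rV[R[i]]_n :=
  \row_i Complex (u.1 0 i) (u.2 0 i).

Lemma complex_row_surj (R : realType) n (d : 'rV[R[i]]_n) :
  complex_row (\row_i complex.Re (d 0 i), \row_i complex.Im (d 0 i)) = d.
Proof. by apply/rowP => i; rewrite !mxE /=; case: (d 0 i). Qed.

Lemma ccontinuous_complex_row (R : realType) n (i : 'I_n) :
  ccontinuous (fun u : 'rV[R]_n * 'rV[R]_n => complex_row u 0 i).
Proof.
split.
  rewrite (_ : (fun u => _) = (fun v : 'rV[R]_n => v 0 i) \o fst).
    by move=> u; apply: continuous_comp; [apply: cvg_fst|apply: coord_continuous].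
  by apply/funext => u; rewrite /= mxE.
rewrite (_ : (fun u => _) = (fun v : 'rV[R]_n => v 0 i) \o snd).
  by move=> u; apply: continuous_comp; [apply: cvg_snd|apply: coord_continuous].
by apply/funext => u; rewrite /= mxE.
Qed.

Lemma abs_Re_le_normc (R : realType) (z : R[i]) : `|complex.Re z| <= normc z.
Proof.
by case: z => a b /=; rewrite -sqrtr_sqr ler_wsqrtr // lerDl sqr_ge0.
Qed.

Lemma abs_Im_le_normc (R : realType) (z : R[i]) : `|complex.Im z| <= normc z.
Proof.
by case: z => a b /=; rewrite -sqrtr_sqr ler_wsqrtr // lerDr sqr_ge0.
Qed.

(** It is a sublevel set of a continuous function, hence closed, and it lies in a product of boxes
    with sides [[- c, c]]. *)
Lemma polydisc_compact (R : realType) n (c : R) :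
  compact [set u : 'rV[R]_n * 'rV[R]_n |
            \big[Num.max/0]_i normc (complex_row u 0 i) <= c].
Proof.
have cbox : compact [set v : 'rV[R]_n | forall i, [set` `[- c, c]] (v 0 i)].
  apply: (@rV_compact _ _ (fun=> [set` `[- c, c]])) => i.
  apply: segment_compact.
apply: subclosed_compact (compact_setX cbox cbox) _.
  apply: (@closed_comp _ _ _ [set x : R | x <= c]); last exact: closed_le.
  move=> u _; apply: continuous_bigmax => i; apply: continuous_normc.
  exact: ccontinuous_complex_row.
move=> u /= uc.
have {}uc i : normc (complex_row u 0 i) <= c.
  by apply: le_trans uc; apply: le_bigmax.
split=> i /=; rewrite in_itv /= -ler_norml; apply: le_trans (uc i).
  by apply: le_trans (abs_Re_le_normc _); rewrite mxE.
by apply: le_trans (abs_Im_le_normc _); rewrite mxE.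
Qed.

(* The zero set meets a closed polydisc in a compact set, so the infimum in [mu]
   is attained; it is positive because the determinant is 1 at [d = 0]. *)
Lemma mu_diag_lt1 (R : realType) n (S : set 'rV[R[i]]_n) (A : 'M[R[i]]_n) :
  closed (@complex_row R n @^-1` S) ->
  mu [set diag_mx d | d in S] A < 1 <->
  forall d, S d -> (forall i, normc (d 0 i) <= 1) ->
    \det (1%:M - A *m diag_mx d) != 0.
Proof.
move=> clS; rewrite /mu; set E := [set _ | _ in S].
case: asboolP => [[_ [d0 Sd0 <-] z0]|noz]; last first.
  split=> // _ d Sd d1; apply/eqP => dz; apply: noz.
  by exists (diag_mx d) => //; exists d.
pose N (u : 'rV[R]_n * 'rV[R]_n) := \big[Num.max/0]_i normc (complex_row u 0 i).
have cN : continuous N.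
  apply: continuous_bigmax => i; apply: continuous_normc.
  exact: ccontinuous_complex_row.
pose f u := \det (1%:M - A *m diag_mx (@complex_row R n u)).
have cf : continuous (fun u => normc (f u)).
  apply: continuous_normc; apply: ccontinuous_det => i j.
  rewrite (_ : (fun u => _) =
               fun u => (1%:M : 'M[R[i]]_n) i j - A i j * complex_row u 0 j).
    apply: ccontinuousD; first exact: ccontinuous_cst.
    apply: ccontinuousN; apply: ccontinuousM; first exact: ccontinuous_cst.
    exact: ccontinuous_complex_row.
  by apply/funext => u; rewrite mul_mx_diag !mxE.
(* Zeros larger than the known zero [d0] cannot lower the infimum, so the zero set is cut off at the
   radius of [d0]; this keeps it nonempty. *)
pose c := \big[Num.max/0]_i normc (d0 0 i).
pose Z := [set u | N u <= c] `&` (@complex_row R n @^-1` S `&` [set u | normc (f u) = 0]).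
have cptZ : compact Z.
  apply: subclosed_compact (@polydisc_compact R n c) _ => [|u []//].
  apply: closedI.
    apply: (@closed_comp _ _ _ [set x : R | x <= c]); last exact: closed_le.
    by move=> u _; apply: cN.
  apply: closedI => //.
  apply: (@closed_comp _ _ _ [set x : R | x = 0]); last exact: closed_eq.
  by move=> u _; apply: cf.
have Z0 : Z !=set0.
  exists (\row_i complex.Re (d0 0 i), \row_i complex.Im (d0 0 i)).
  rewrite /Z /N /f /=; split; first by rewrite /= complex_row_surj.
  by split; rewrite /= complex_row_surj // z0 Normc.normc0.
have [u Zu uP] := compact_EVT_min Z0 cptZ (continuous_subspaceT cN).
move: Zu; rewrite inE => -[uc [Su /Normc.eq0_normc fu]].
have N0 : 0 < N u.
  rewrite lt_neqAle bigmax_ge_id andbT; apply/eqP => Nu0.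
  move: fu; rewrite /f (_ : complex_row u = 0).
    by rewrite raddf0 mulmx0 subr0 det1 => /eqP; rewrite oner_eq0.
  apply/rowP => i; rewrite [RHS]mxE; apply: Normc.eq0_normc; apply/le_anti.
  by rewrite normc_ge0 andbT Nu0; apply: le_bigmax.
have minN d : S d -> \det (1%:M - A *m diag_mx d) = 0 ->
    N u <= opnorm (diag_mx d).
  move=> Sd dz; rewrite opnorm_diag leNgt; apply/negP => dlt.
  pose w := (\row_i complex.Re (d 0 i), \row_i complex.Im (d 0 i)).
  suff /uP : w \in Z by rewrite /N complex_row_surj leNgt dlt.
  rewrite inE /Z /N /f /=; split=> /=.
    by rewrite complex_row_surj; apply: le_trans (ltW dlt) uc.
  by split; rewrite /= complex_row_surj // dz Normc.normc0.
rewrite (_ : inf _ = N u).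
  rewrite div1r invf_lt1 //; split=> [Nu1 d Sd d1|nz].
    apply/eqP => /minN -/(_ Sd); rewrite leNgt => /negP; apply.
    by apply: le_lt_trans Nu1; apply/opnorm_diag_le.
  rewrite ltNge; apply/negP => Nu1; move/eqP: fu; apply/negP; apply: nz => // i.
  by apply: le_trans Nu1; apply: le_bigmax.
apply/le_anti/andP; split.
  apply: ge_inf; first by exists 0 => _ [X _ <-]; apply: opnorm_ge0.
  by exists (diag_mx (complex_row u)); [split=> //; exists (complex_row u)|rewrite opnorm_diag].
apply: lb_le_inf.
  by exists (opnorm (diag_mx d0)), (diag_mx d0) => //; split=> //; exists d0.
by move=> _ [_ [[d Sd <-] dz] <-]; apply: minN.
Qed.

(** * The determinant polynomial and surjectivity of [pi7] and [pi5] *)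

Lemma det_mx33 (R : comNzRingType) (M : 'M[R]_3) :
  \det M = M 0 0 * (M 1 1 * M 2 2 - M 1 2 * M 2 1)
         - M 0 1 * (M 1 0 * M 2 2 - M 1 2 * M 2 0)
         + M 0 2 * (M 1 0 * M 2 1 - M 1 1 * M 2 0).
Proof.
(* Indexing the entries by natural numbers lets the indices of the cofactors reduce by
   computation. *)
pose f (i j : nat) := M (inord i) (inord j).
have -> : M = \matrix_(i < 3, j < 3) f i j.
  by apply/matrixP => i j; rewrite mxE /f !inord_val.
rewrite (expand_det_row _ 0) !big_ord_recl big_ord0 /cofactor !mxE.
rewrite !(expand_det_row _ 0) !big_ord_recl !big_ord0 /cofactor !det_mx11 !mxE /=.
rewrite /bump /=; ring.
Qed.

(** At the coordinates of [pi7 A], the coefficient of a monomial of degree k is (-1)^k times the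
    principal minor of [A] on its indices. *)
Definition multiaffine (K : nzRingType) (x1 x2 x3 x4 x5 x6 x7 z1 z2 z3 : K) : K :=
  1 - x1 * z1 - x2 * z2 + x3 * (z1 * z2) - x4 * z3 + x5 * (z1 * z3)
    + x6 * (z2 * z3) - x7 * (z1 * z2 * z3).

Lemma multiaffineC (K : comNzRingType) (x1 x2 x3 x4 x5 x6 x7 z1 z2 z3 : K) :
  multiaffine x1 x2 x3 x4 x5 x6 x7 z1 z2 z3 =
  multiaffine x1 x4 x5 x2 x3 x6 x7 z1 z3 z2.
Proof. rewrite /multiaffine; ring. Qed.

Lemma det_1BM_diag (K : comNzRingType) (A : 'M[K]_3) (d : 'rV[K]_3) :
  \det (1%:M - A *m diag_mx d) =
  multiaffine (A 0 0) (A 1 1) (A 0 0 * A 1 1 - A 0 1 * A 1 0) (A 2 2)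
    (A 0 0 * A 2 2 - A 0 2 * A 2 0) (A 1 1 * A 2 2 - A 1 2 * A 2 1) (\det A)
    (d 0 0) (d 0 1) (d 0 2).
Proof.
rewrite mul_mx_diag !det_mx33 !mxE /= /multiaffine; ring.
Qed.

Definition mx33 (K : zmodType) (a b c a' b' c' a'' b'' c'' : K) : 'M[K]_3 :=
  \matrix_(i, j) (nth [::] [:: [:: a; b; c]; [:: a'; b'; c']; [:: a''; b''; c'']] i)`_j.

(** The two 3-cycle products have sum [e] and product [p * q * r], so they are the roots of
    [t^2 - e t + p q r]. A nonzero root yields the entries by division; if both roots vanish, then
    [e = 0] and one of [p], [q], [r] is 0. *)
Lemma off_diagonal_products (R : realType) (p q r e : R[i]) :
  exists a12 a13 a21 a23 a31 a32 : R[i],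
    [/\ a12 * a21 = p, a13 * a31 = q, a23 * a32 = r
      & a12 * a23 * a31 + a13 * a32 * a21 = e].
Proof.
have [s sE] : exists s, s * (e - s) = p * q * r.
  pose w := complex.sqrtc (e ^+ 2 - 4 * (p * q * r)).
  have wE : w ^+ 2 = e ^+ 2 - 4 * (p * q * r) by apply: complex.sqr_sqrtc.
  exists ((e + w) / 2).
  have -> : (e + w) / 2 * (e - (e + w) / 2) = (e ^+ 2 - w ^+ 2) / 4 by field.
  by rewrite wE; field.
have nonzero_root t : t != 0 -> t * (e - t) = p * q * r ->
  exists a12 a13 a21 a23 a31 a32 : R[i],
    [/\ a12 * a21 = p, a13 * a31 = q, a23 * a32 = r
      & a12 * a23 * a31 + a13 * a32 * a21 = e].
  (* With these entries the first 3-cycle product is [t] and the second is [p q r / t = e - t]. *)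
  move=> t0 tE; exists 1, (q / t), p, 1, t, r; rewrite !mul1r; split=> //.
    by rewrite divfK.
  have -> : q / t * r * p = (p * q * r) / t by field.
  by rewrite -tE; field.
have [s0|] := eqVneq s 0; last by move/nonzero_root; apply.
have pqr0 : p * q * r = 0 by rewrite -sE s0 mul0r.
(* When [s = 0] the other root is [e]. *)
have [e0|] := eqVneq e 0; last first.
  by move/nonzero_root; apply; rewrite subrr mulr0.
move/eqP: pqr0; rewrite e0 !mulf_eq0 => /orP[/orP[]|] /eqP ->.
(* Both entries of the pair with product 0 are set to 0; each 3-cycle uses one of them, so both
   cycle products vanish. *)
- by exists 0, 1, 0, 1, q, r; rewrite !(mul0r, mulr0, mul1r, addr0).
- by exists 1, 0, p, 1, 0, r; rewrite !(mul0r, mulr0, mul1r, addr0).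
- by exists 1, 1, p, 0, q, 0; rewrite !(mul0r, mulr0, mul1r, addr0).
Qed.

Lemma pi7_surj (R : realType) (x1 x2 x3 x4 x5 x6 x7 : R[i]) :
  exists A : 'M[R[i]]_3, pi7 A = [tuple x1; x2; x3; x4; x5; x6; x7].
Proof.
(* The diagonal is [x1], [x2], [x4]. The 2 x 2 minors fix the products of opposite entries, and
   solving Sarrus's rule for determinant [x7] fixes the sum of the 3-cycle products. *)
have [a12 [a13 [a21 [a23 [a31 [a32 [pE qE rE eE]]]]]]] :=
  off_diagonal_products (x1 * x2 - x3) (x1 * x4 - x5) (x2 * x4 - x6)
    (x7 - x1 * x2 * x4 + x1 * (x2 * x4 - x6) + x2 * (x1 * x4 - x5)
      + x4 * (x1 * x2 - x3)).
pose A := mx33 x1 a12 a13 a21 x2 a23 a31 a32 x4.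
have detA : \det A = x7.
  apply/eqP; rewrite -subr_eq0; apply/eqP.
  transitivity ((a12 * a23 * a31 + a13 * a32 * a21)
    - (x7 - x1 * x2 * x4 + x1 * (a23 * a32) + x2 * (a13 * a31)
       + x4 * (a12 * a21))); last by rewrite pE qE rE eE subrr.
  by rewrite det_mx33 !mxE /=; ring.
exists A; apply/val_inj; rewrite /= detA !mxE /= pE qE rE.
by rewrite !subKr.
Qed.

Lemma pi5_surj (R : realType) (y1 y2 y3 y4 y5 : R[i]) :
  exists A : 'M[R[i]]_3, pi5 A = [tuple y1; y2; y3; y4; y5].
Proof.
(* Each coordinate of [pi5] that is a sum is put entirely in its first summand. *)
have [A /(congr1 val)[A1 A2 A3 A4 A5 A6 A7]] := pi7_surj y1 y4 y2 0 0 y5 y3.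
by exists A; apply/val_inj; rewrite /= A3 A5 A6 A7 A1 A2 A4 !addr0.
Qed.

(** * Membership in the two domains as non-vanishing of the polynomial *)

(** The condition [mu < 1] depends on [A] only through [pi7 A], so any matrix over the point can be
    used. *)
Lemma G_3_3_111P (R : realType) (x1 x2 x3 x4 x5 x6 x7 : R[i]) :
  G_3_3_111 [tuple x1; x2; x3; x4; x5; x6; x7] <->
  forall z1 z2 z3 : R[i], normc z1 <= 1 -> normc z2 <= 1 -> normc z3 <= 1 ->
    multiaffine x1 x2 x3 x4 x5 x6 x7 z1 z2 z3 != 0.
Proof.
have muE A : mu (@E_3_3_111 R) A < 1 <->
    forall z1 z2 z3 : R[i], normc z1 <= 1 -> normc z2 <= 1 -> normc z3 <= 1 ->
    multiaffine (A 0 0) (A 1 1) (A 0 0 * A 1 1 - A 0 1 * A 1 0) (A 2 2)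
    (A 0 0 * A 2 2 - A 0 2 * A 2 0) (A 1 1 * A 2 2 - A 1 2 * A 2 1) (\det A)
      z1 z2 z3 != 0.
  have -> : @E_3_3_111 R = [set diag_mx d | d in setT].
    apply/seteqP; split=> [X /diag_mxP[d ->]|_ [d _ <-]]; first by exists d.
    exact: diag_mx_is_diag.
  rewrite mu_diag_lt1; last by rewrite preimage_setT; apply: closedT.
  split=> [nz z1 z2 z3 h1 h2 h3|nz d _ d1].
    have := nz (\row_i [:: z1; z2; z3]`_i) I.
    rewrite det_1BM_diag !mxE /=; apply => i; rewrite mxE.
    by case: i => [[|[|[|//]]] lt_i3].
  by rewrite det_1BM_diag; apply: nz.
split=> [[A /muE nz /(congr1 val)[<- <- <- <- <- <- <-]] //|nz].
have [A piA] := pi7_surj x1 x2 x3 x4 x5 x6 x7; exists A => //; apply/muE.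
by case: (congr1 val piA) => -> -> -> -> -> -> ->.
Qed.

(** Substituting [z3 = eta * z2] merges monomials, and the five resulting coefficients are, up to
    sign, the coordinates of the point on the left. *)
Lemma G_3_2_12P (R : realType) (x1 x2 x3 x4 x5 x6 x7 eta : R[i]) :
  G_3_2_12 [tuple x1; x3 + eta * x5; eta * x7; x2 + eta * x4; eta * x6] <->
  forall z1 z2 : R[i], normc z1 <= 1 -> normc z2 <= 1 ->
    multiaffine x1 x2 x3 x4 x5 x6 x7 z1 z2 (eta * z2) != 0.
Proof.
have multiaffineE (a b c d e f g z w : R[i]) : multiaffine a b c d e f g z w w =
    1 - a * z + (c + e) * (z * w) - g * (z * w * w) - (b + d) * w + f * (w * w).
  by rewrite /multiaffine; ring.
have muE A : mu (@E_3_2_12 R) A < 1 <->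
    forall z1 z2 : R[i], normc z1 <= 1 -> normc z2 <= 1 ->
    multiaffine (A 0 0) (A 1 1) (A 0 0 * A 1 1 - A 0 1 * A 1 0) (A 2 2)
    (A 0 0 * A 2 2 - A 0 2 * A 2 0) (A 1 1 * A 2 2 - A 1 2 * A 2 1) (\det A)
      z1 z2 z2 != 0.
  have -> : @E_3_2_12 R = [set diag_mx d | d in [set d : 'rV[R[i]]_3 | d 0 1 = d 0 2]].
    apply/seteqP; split=> [_ [z1 [z2 ->]]|_ [d /= d12 <-]].
      by exists (\row_i [:: z1; z2; z2]`_i); rewrite //= !mxE.
    exists (d 0 0), (d 0 1); congr diag_mx; apply/rowP => i; rewrite !mxE.
    by case: i => [[|[|[|//]]] lt_i3] /=; [| |rewrite d12];
      congr (d 0); apply/val_inj.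
  rewrite mu_diag_lt1; last first.
    (* Closedness follows by writing the condition as the zero set of a continuous real function. *)
    rewrite (_ : _ @^-1` _ = (fun u : 'rV[R]_3 * 'rV[R]_3 =>
        normc (complex_row u 0 1 - complex_row u 0 2)) @^-1` [set x | x = 0]).
      apply: closed_comp; last exact: closed_eq.
      move=> u _; apply: continuous_normc; apply: ccontinuousD.
        exact: ccontinuous_complex_row.
      by apply: ccontinuousN; apply: ccontinuous_complex_row.
    apply/seteqP; split=> [u /= ->|u /= /Normc.eq0_normc /eqP].
      by rewrite subrr Normc.normc0.
    by rewrite subr_eq0 => /eqP.
  split=> [nz z1 z2 h1 h2|nz d /= d12 d1].
    have := nz (\row_i [:: z1; z2; z2]`_i).
    rewrite det_1BM_diag /= !mxE /=; apply => // i; rewrite mxE.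
    by case: i => [[|[|[|//]]] lt_i3].
  by rewrite det_1BM_diag -d12; apply: nz.
have etaE z1 z2 : multiaffine x1 x2 x3 x4 x5 x6 x7 z1 z2 (eta * z2) =
    1 - x1 * z1 + (x3 + eta * x5) * (z1 * z2) - (eta * x7) * (z1 * z2 * z2)
    - (x2 + eta * x4) * z2 + (eta * x6) * (z2 * z2).
  by rewrite /multiaffine; ring.
split=> [[A /muE nz /(congr1 val)[A1 A2 A3 A4 A5]] z1 z2 h1 h2|nz].
  by have := nz z1 z2 h1 h2; rewrite multiaffineE A2 A3 A4 A5 A1 etaE.
have [A piA] := pi5_surj x1 (x3 + eta * x5) (eta * x7) (x2 + eta * x4) (eta * x6).
exists A => //; apply/muE => z1 z2 h1 h2; rewrite multiaffineE.
by case: (congr1 val piA) => -> -> -> -> ->; rewrite -etaE; apply: nz.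
Qed.

(** * From the unit circle to the closed polydisc *)

(* On the unit circle non-vanishing of [a + eta * b] means [normc a != normc b];
   the sign of the difference is constant along the path. *)
Lemma affine_nonvanishing_disc (R : realType) (a b : R -> R[i]) :
  ccontinuous a -> ccontinuous b -> b 0 = 0 ->
  (forall t, 0 <= t <= 1 -> forall eta, normc eta = 1 -> a t + eta * b t != 0) ->
  forall eta, normc eta <= 1 -> a 1 + eta * b 1 != 0.
Proof.
move=> ca cb b0 nz eta eta1.
pose g t := normc (a t) - normc (b t).
have cg : continuous g.
  by move=> t; apply: cvgB; apply: continuous_normc.
have g0 : 0 < g 0.
  rewrite /g b0 Normc.normc0 subr0 lt_neqAle normc_ge0 andbT eq_sym.
  apply/eqP => /Normc.eq0_normc a0.
  have := nz 0 _ 1 (Normc.normc1 _); rewrite lexx ler01 => /(_ isT).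
  by rewrite a0 b0 mulr0 addr0 eqxx.
have g1 : 0 < g 1.
  rewrite ltNge; apply/negP => g1.
  have [|c] := @IVT R g 0 1 0 ler01 (continuous_subspaceT cg).
    by rewrite ge_min g1 orbT le_max (ltW g0).
  rewrite in_itv /= => c01 /eqP; rewrite subr_eq0 => /eqP ab.
  (* At a crossing either [a c] and [b c] both vanish, or [- (a c / b c)] is a zero on the unit
     circle. *)
  have [bc0|bc0] := eqVneq (b c) 0.
    have := nz c c01 1 (Normc.normc1 _).
    rewrite bc0 mulr0 addr0 => /eqP; apply.
    by apply: Normc.eq0_normc; rewrite ab bc0 Normc.normc0.
  have := nz c c01 (- (a c / b c)); rewrite mulNr divfK // subrr eqxx.
  rewrite normcN Normc.normcM Normc.normcV ab divff => [/(_ erefl)//|].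
  by apply: contra bc0 => /eqP /Normc.eq0_normc ->.
apply/eqP => /eqP; rewrite addr_eq0 => /eqP a1.
move: g1; rewrite /g a1 normcN Normc.normcM subr_gt0 ltNge => /negP; apply.
by rewrite ler_piMl // normc_ge0.
Qed.

Lemma multiaffine_nonvanishing (R : realType)
    (x1 x2 x3 x4 x5 x6 x7 z1 z2 z3 : R[i]) :
  (forall z w eta, normc z <= 1 -> normc w <= 1 -> normc eta = 1 ->
    multiaffine x1 x2 x3 x4 x5 x6 x7 z w (eta * w) != 0) ->
  normc z1 <= 1 -> normc z2 <= 1 -> normc z3 <= normc z2 ->
  multiaffine x1 x2 x3 x4 x5 x6 x7 z1 z2 z3 != 0.
Proof.
move=> nz z1_le1 z2_le1 le32.
pose s (t : R) (z : R[i]) := (t%:C)%C * z.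
have s_le1 t z : 0 <= t <= 1 -> normc z <= 1 -> normc (s t z) <= 1.
  move=> /andP[t0 t1] hz; rewrite Normc.normcM /= expr0n addr0 sqrtr_sqr.
  by rewrite ger0_norm // mulr_ile1 ?normc_ge0.
have cs z : ccontinuous (s ^~ z).
  apply: ccontinuousM; last exact: ccontinuous_cst.
  by split=> t; [apply: cvg_id|apply: cvg_cst].
have cst c : ccontinuous (fun _ : R => c : R[i]) by apply: ccontinuous_cst.
pose a t := 1 - x1 * s t z1 - x2 * s t z2 + x3 * (s t z1 * s t z2).
(* The terms containing [z3], with [eta] taken out; the factor [s t z2] makes [b] vanish at
   [t = 0]. *)
pose b t := (- x4 + x5 * s t z1 + x6 * s t z2 - x7 * (s t z1 * s t z2)) * s t z2.
have abE t eta : a t + eta * b t =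
    multiaffine x1 x2 x3 x4 x5 x6 x7 (s t z1) (s t z2) (eta * s t z2).
  by rewrite /a /b /multiaffine; ring.
(* If [z2 = 0] then [z3 = 0], so the identity survives, and [0^-1 = 0] puts the ratio at 0, inside
   the disc. *)
have z3E : z3 = z3 / z2 * z2.
  have [z20|] := eqVneq z2 0; last by move=> ?; rewrite divfK.
  rewrite z20 mulr0; apply: Normc.eq0_normc; apply/le_anti.
  by rewrite normc_ge0 andbT (le_trans le32) // z20 Normc.normc0.
have -> : multiaffine x1 x2 x3 x4 x5 x6 x7 z1 z2 z3 = a 1 + z3 / z2 * b 1.
  by rewrite abE /s !mul1r -z3E.
apply: affine_nonvanishing_disc.
- by apply: (ccontinuousD (ccontinuousD (ccontinuousD (cst 1)
    (ccontinuousN (ccontinuousM (cst x1) (cs z1))))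
    (ccontinuousN (ccontinuousM (cst x2) (cs z2))))
    (ccontinuousM (cst x3) (ccontinuousM (cs z1) (cs z2)))).
- by apply: (ccontinuousM (ccontinuousD (ccontinuousD (ccontinuousD (cst (- x4))
    (ccontinuousM (cst x5) (cs z1))) (ccontinuousM (cst x6) (cs z2)))
    (ccontinuousN (ccontinuousM (cst x7) (ccontinuousM (cs z1) (cs z2)))))
    (cs z2)).
- by rewrite /b [s 0 z2]mul0r !mulr0.
- by move=> t t01 eta eta1; rewrite abE; apply: nz => //; apply: s_le1.
- rewrite Normc.normcM Normc.normcV.
  have [->|z20] := eqVneq (normc z2) 0; first by rewrite invr0 mulr0.
  by rewrite ler_pdivrMr ?mul1r // lt_neqAle normc_ge0 andbT eq_sym.
Qed.

Theorem theorem2p45 (R : realType) (x1 x2 x3 x4 x5 x6 x7 : R[i]) :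
  [<-> G_3_3_111 [tuple x1; x2; x3; x4; x5; x6; x7];
       forall eta : R[i], `|eta| = 1 ->
         G_3_2_12 [tuple x1; x3 + eta * x5; eta * x7; x2 + eta * x4; eta * x6];
       forall eta : R[i], `|eta| <= 1 ->
         G_3_2_12 [tuple x1; x3 + eta * x5; eta * x7; x2 + eta * x4; eta * x6]].
Proof.
have normc_le1 (z : R[i]) : (`|z| <= 1) = (normc z <= 1).
  by rewrite normrE lecR.
have normc_eq1 (z : R[i]) : `|z| = 1 <-> normc z = 1.
  by rewrite normrE; split=> [[]|->].
(* Condition (1) gives (3) by restriction to [z3 = eta * z2], and (3) contains (2); the work is in
   (2) to (1). *)
suff main : (forall eta : R[i], `|eta| = 1 ->
    G_3_2_12 [tuple x1; x3 + eta * x5; eta * x7; x2 + eta * x4; eta * x6]) ->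
    G_3_3_111 [tuple x1; x2; x3; x4; x5; x6; x7].
  have easy : G_3_3_111 [tuple x1; x2; x3; x4; x5; x6; x7] ->
    forall eta : R[i], `|eta| <= 1 ->
    G_3_2_12 [tuple x1; x3 + eta * x5; eta * x7; x2 + eta * x4; eta * x6].
    move=> /G_3_3_111P nz eta; rewrite normc_le1 => eta1.
    apply/G_3_2_12P => z1 z2 h1 h2; apply: nz => //.
    by rewrite Normc.normcM mulr_ile1 ?normc_ge0.
  tfae => [G3 eta eta1|/main //|G2]; first by apply: easy => //; rewrite eta1.
  by apply: main => eta eta1; apply: G2; rewrite eta1.
move=> G2; apply/G_3_3_111P => z1 z2 z3 h1 h2 h3.
have nz z w eta : normc z <= 1 -> normc w <= 1 -> normc eta = 1 ->
    multiaffine x1 x2 x3 x4 x5 x6 x7 z w (eta * w) != 0.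
  by move=> hz hw /normc_eq1 /G2 /G_3_2_12P; apply.
have [le32|/ltW le23] := leP (normc z3) (normc z2).
  exact: multiaffine_nonvanishing.
rewrite multiaffineC; apply: multiaffine_nonvanishing => // z w eta hz hw eta1.
have eta0 : eta != 0.
  by apply/eqP => eta0; move: eta1 => /eqP; rewrite eta0 Normc.normc0 eq_sym oner_eq0.
(* Exchanged back, the point [(eta * w, w)] has parameter [eta^-1], again on the unit circle. *)
rewrite multiaffineC -{2}(mulKf eta0 w); apply: nz => //.
  by rewrite Normc.normcM eta1 mul1r.
by rewrite Normc.normcV eta1 invr1.
Qed.
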